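(* Let $\mathfrak M$ be a partial Steiner triple system and $m\ge 3$ an integer. The structure $\circledast^{m}\mathfrak M$ does not contain any Desargues subconfiguration. Actually, it is anti-Desarguesian: no three focuses of two perspective triangles contained in $\circledast^{m}\mathfrak M$ are collinear.
   Context: A partial Steiner triple system (PSTS) is a structure $\mathfrak M=\langle S,\mathcal L\rangle$ with point set $S$ and a family $\mathcal L$ of 3-element subsets of $S$ (lines) such that any two distinct points lie on at most one line. Points are collinear if they lie on a common line. $C_m$ is the cyclic group of integers modulo $m$. For an integer $m\ge 3$, the $m$-weaved configuration $\circledast^{m}\mathfrak M$ has point set $S\times C_m$ and its lines are all the sets $\{(a,i),(b,i),(c,i+1)\}$ with $\{a,b,c\}\in\mathcal L$ (in any ordering of $a,b,c$) and $i\in C_m$; it is again a PSTS. A triangle is a triple of pairwise collinear points not on a line. Two triangles $(x_1,x_2,x_3)$, $(y_1,y_2,y_3)$ (with six distinct vertices) are perspective with center $p$ if $\{p,x_j,y_j\}$ is a line for $j=1,2,3$, these lines being pairwise distinct. A focus of the two triangles is the common point of the side through $x_j,x_k$ and the side through $y_j,y_k$ ($j\ne k$), if it exists; the anti-Desarguesian property says that whenever all three focuses exist they do not lie on a common line. A Desargues subconfiguration is the usual $10_3$ Desargues configuration (10 points, 10 lines): two perspective triangles, their center and three collinear focuses. *)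

(* Defs.v *)
From mathcomp Require Import all_boot all_order all_algebra.
From mathcomp Require Import all_classical.

Set Implicit Arguments.
Unset Strict Implicit.
Unset Printing Implicit Defensive.

Import GRing.Theory.
Local Open Scope classical_set_scope.
Local Open Scope card_scope.
Local Open Scope ring_scope.

(* The point set is an arbitrary type [S], finite or not. *)
Definition is_psts (S : Type) (L : set (set S)) : Prop :=
  (forall A, L A -> A #= `I_3) /\
  (forall A B x y, L A -> L B -> x <> y ->
     A x -> A y -> B x -> B y -> A = B).

(* [set a; b; c] does not depend on the order of a, b, c, so every choice of
   the raised point c is covered. In a partial Steiner triple system,
   L [set a; b; c] forces a, b, c to be distinct. 'Z_m is the group C_m only
   for 1 < m. *)
Definition weave (S : Type) (m : nat) (L : set (set S)) :
    set (set (S * 'Z_m)) :=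
  [set A | exists (a b c : S) (i : 'Z_m),
     L [set a; b; c] /\ A = [set (a, i); (b, i); (c, i + 1)]].

Arguments weave {S} m L _.

Definition collinear (S : Type) (L : set (set S)) (x y : S) : Prop :=
  exists A, [/\ L A, A x & A y].

Definition on_common_line (S : Type) (L : set (set S)) (x : 'I_3 -> S) : Prop :=
  exists2 A, L A & forall j, A (x j).

Definition triangle (S : Type) (L : set (set S)) (x : 'I_3 -> S) : Prop :=
  (forall j k : 'I_3, j != k -> collinear L (x j) (x k)) /\ ~ on_common_line L x.

Definition perspective (S : Type) (L : set (set S)) (p : S)
    (x y : 'I_3 -> S) : Prop :=
  [/\ triangle L x /\ triangle L y,
      [/\ injective x, injective y & forall j k, x j <> y k],
      forall j, L [set p; x j; y j] &
      injective (fun j => [set p; x j; y j])].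

(* In a partial Steiner triple system the line through two distinct collinear
   points is unique, so A and B are the two sides; for perspective triangles
   they differ, so f is their only common point. *)
Definition focus (S : Type) (L : set (set S)) (x y : 'I_3 -> S)
    (j k : 'I_3) (f : S) : Prop :=
  exists A B, [/\ L A, A (x j) & A (x k)] /\ [/\ L B, B (y j) & B (y k)] /\
              A f /\ B f.

(* [f i] is the focus on the sides opposite to the i-th vertices. *)
Definition focuses (S : Type) (L : set (set S)) (x y f : 'I_3 -> S) : Prop :=
  forall i j k : 'I_3, uniq [:: i; j; k] -> focus L x y j k (f i).

Definition anti_desarguesian (S : Type) (L : set (set S)) : Prop :=
  forall (p : S) (x y f : 'I_3 -> S),
    perspective L p x y -> focuses L x y f -> ~ on_common_line L f.

(* The lines of K are, in this order: the three lines through the center p,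
   the three sides of each of the triangles x, y, and the axis. *)
Definition desargues_configuration (S : Type) (P : set S) (K : set (set S)) :
    Prop :=
  exists (p : S) (x y f : 'I_3 -> S),
    [/\ P = [set p] `|` range x `|` range y `|` range f,
        P #= `I_10,
        K = range (fun j => [set p; x j; y j])
            `|` [set A | exists i j k : 'I_3,
                   uniq [:: i; j; k] /\ A = [set x j; x k; f i]]
            `|` [set A | exists i j k : 'I_3,
                   uniq [:: i; j; k] /\ A = [set y j; y k; f i]]
            `|` [set range f] &
        K #= `I_10].

Definition desargues_subconfiguration (S : Type) (L : set (set S))
    (P : set S) (K : set (set S)) : Prop :=
  desargues_configuration P K /\ K `<=` L.

(* Main.v *)
(* Call the second coordinate of a point its level. Every line of the weaved
   configuration has levels i, i, i+1, so the level of two of its points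
   determines that of the third. View the points of a Desargues configuration
   as the edges of the complete graph on five vertices and its lines as the
   triangles. If two of the four edges at a vertex have the same level i, then
   the triangles through a third edge force its level to be i+1; hence the
   other two edges both have level i+1, and the same argument applied to them
   gives i = i+2, which is impossible for m >= 3. So the four edges at a vertex
   have distinct levels, although three of them lie among i-1 and i+1. *)

Require Import Defs.
From mathcomp Require Import all_boot all_order all_algebra.
From mathcomp Require Import all_classical.

Set Implicit Arguments.
Unset Strict Implicit.
Unset Printing Implicit Defensive.

Import GRing.Theory.
Local Open Scope classical_set_scope.
Local Open Scope card_scope.
Local Open Scope ring_scope.

(** * Three-element sets, counting and triples of indices *)

Section SetOfThree.
Variable T : Type.
Implicit Types (a b c : T) (A : set T).

Lemma set3E a b c z : [set a; b; c] z <-> [\/ z = a, z = b | z = c].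
Proof.
split; first by move=> [[->|->]|->]; [apply: Or31|apply: Or32|apply: Or33].
by move=> [->|->|->]; [left; left|left; right|right].
Qed.

Lemma set3P A a b c :
  (forall z, A z <-> [\/ z = a, z = b | z = c]) -> A = [set a; b; c].
Proof. by move=> h; apply/seteqP; split=> z; rewrite set3E => /h. Qed.

Lemma set3C a b c : [set a; b; c] = [set b; a; c].
Proof. by rewrite (setUC [set a]). Qed.

Lemma set3AC a b c : [set a; b; c] = [set a; c; b].
Proof. by rewrite setUAC. Qed.

Lemma mem3a a b c : [set a; b; c] a. Proof. by rewrite set3E; apply: Or31. Qed.
Lemma mem3b a b c : [set a; b; c] b. Proof. by rewrite set3E; apply: Or32. Qed.
Lemma mem3c a b c : [set a; b; c] c. Proof. by rewrite set3E; apply: Or33. Qed.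

End SetOfThree.

(** A bijection of the range with [I_n] turns [g] into a surjection [k] onto ['I_n]. A section [s]
    of [k] is injective between types of equal size, hence bijective, so [k] is injective and with
    it [g]. *)
Lemma card_range_inj (T : Type) (D : finType) (g : D -> T) (n : nat) :
  #|D| = n -> range g #= `I_n -> injective g.
Proof.
move=> cD /card_set_bijP[h [hI hinj hS]].
pose k (d : D) : 'I_n := Ordinal (hI _ (imageT g d)).
have [s sK] : exists s : 'I_n -> D, cancel s k.
  have ex (i : 'I_n) : exists d, k d = i.
    have [_ [d _ <-] hd] := hS i (ltn_ord i).
    by exists d; apply: val_inj.
  by have [s sP] := choice ex; exists s.
have [s' s's ss'] : bijective s.
  by apply: inj_card_bij (can_inj sK) _; rewrite cD card_ord.
have kinj : injective k.
  by apply: (can_inj (g := s)) => d; rewrite -{1}[d]ss' sK ss'.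
by move=> d e gde; apply: kinj; apply: val_inj; rewrite /= gde.
Qed.

Lemma card_set3_neq (T : Type) (a b c : T) :
  [set a; b; c] #= `I_3 -> [/\ a <> b, a <> c & b <> c].
Proof.
pose g (i : 'I_3) := if i == 0 then a else if i == 1 then b else c.
have -> : [set a; b; c] = range g.
  apply/esym/set3P => z; split.
    by move=> [i _ <-]; rewrite /g; case: ifP => _; last case: ifP => _;
      [apply: Or31|apply: Or32|apply: Or33].
  by move=> [->|->|->]; [exists 0|exists 1|exists 2%:R].
move=> /(card_range_inj (card_ord 3)) ginj; split => e.
- by have /ginj : g 0 = g 1 by [].
- by have /ginj : g 0 = g 2%:R by [].
- by have /ginj : g 1 = g 2%:R by [].
Qed.

Lemma mem_uniq_ord3 (i j k l : 'I_3) : uniq [:: i; j; k] -> l \in [:: i; j; k].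
Proof.
move=> /card_uniqP c3; suff -> : [:: i; j; k] =i predT by [].
by apply/subset_cardP; rewrite ?c3 ?card_ord ?subset_predT.
Qed.

Lemma ord3_third (j k : 'I_3) : j != k -> exists i : 'I_3, uniq [:: i; j; k].
Proof.
(* The three elements of ['I_3] sum to 0 modulo 3. *)
move=> njk; exists (- (j + k)).
by case: j k njk => [[|[|[|//]]] ?] [[|[|[|//]]] ?].
Qed.

(** * Levels along lines *)

Section Levels.
Variable R : nzRingType.
Hypothesis two_neq0 : 1 + 1 != 0 :> R.
Implicit Types a b c d : R.

Lemma addr1_neq a : a + 1 <> a.
Proof. by rewrite -[RHS]addr0 => /addrI/eqP; rewrite oner_eq0. Qed.

Lemma addr2_neq a : a + 1 + 1 <> a.
Proof. by rewrite -addrA -[RHS]addr0 => /addrI/eqP; apply/negP. Qed.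

(** One case for each choice of the raised point, which keeps the relation symmetric. *)
Definition line_levels a b c : Prop :=
  [\/ a = b /\ c = a + 1, a = c /\ b = a + 1 | b = c /\ a = b + 1].

Lemma line_levelsC a b c : line_levels a b c -> line_levels b a c.
Proof.
by move=> [[-> ->]|[-> ->]|[-> ->]];
  [apply: Or31|apply: Or33|apply: Or32].
Qed.

Lemma line_levelsAC a b c : line_levels a b c -> line_levels a c b.
Proof.
by move=> [[-> ->]|[-> ->]|[-> ->]];
  [apply: Or32|apply: Or31|apply: Or33].
Qed.

(** Equal levels put the third point one higher; otherwise it takes the lower of the two, and which
    one is lower is unambiguous because [1 + 1] is nonzero. *)
Lemma line_levels_fun a b c d :
  line_levels a b c -> line_levels a b d -> c = d.
Proof.
move=> [[<- ->]|[<- ->]|[-> ->]] [[h1 h2]|[h1 h2]|[h1 h2]].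
- by rewrite h2.
- by case: (addr1_neq (esym h2)).
- by case: (addr1_neq (esym h2)).
- by case: (addr1_neq (esym h1)).
- exact: h1.
- by case: (addr2_neq (esym h2)).
- by case: (addr1_neq h1).
- by case: (addr2_neq (esym h2)).
- exact: h1.
Qed.

(** If [a = b], then [ac = bc] and [ab = a + 1]. Now [c = a] would put the whole triangle [ab],
    [ac], [bc] on one level, and [a = c + 1] would put [ab] two levels above [ac] and [bc]. *)
Lemma concurrent_levels a b c ab ac bc :
  line_levels a b ab -> line_levels a c ac -> line_levels b c bc ->
  line_levels ab ac bc -> a = b -> c = a + 1.
Proof.
move=> hab hac hbc h eab; subst b.
have eac := line_levels_fun hac hbc; subst bc.
have ? : ab = a + 1 by apply: line_levels_fun hab _; apply: Or31.
subst ab.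
case: hac => [[e1 e2]|[_ ->]|[e1 e2]] //.
  by subst; case: h => [[_ h]|[_ h]|[_ h]]; case: (@addr1_neq _ (esym h)).
subst; case: h => [[h _]|[h _]|[_ h]].
- by case: (addr2_neq h).
- by case: (addr2_neq h).
- by case: (addr1_neq h).
Qed.

Lemma four_concurrent_levels_neq a b c d ab ac ad bc bd cd :
  line_levels a b ab -> line_levels a c ac -> line_levels a d ad ->
  line_levels b c bc -> line_levels b d bd -> line_levels c d cd ->
  line_levels ab ac bc -> line_levels ab ad bd -> line_levels ac ad cd ->
  a <> b.
Proof.
move=> hab hac had hbc hbd hcd habc habd hacd eab.
have ec := concurrent_levels hab hac hbc habc eab.
have ed := concurrent_levels hab had hbd habd eab.
(* Roles exchanged: [c] and [d] now share a level, and [a] is the third edge. *)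
have : a = c + 1.
  apply: (concurrent_levels hcd (line_levelsC hac) (line_levelsC had)).
    exact/line_levelsC/line_levelsAC.
  by rewrite ec ed.
by rewrite ec => h; case: (@addr2_neq a).
Qed.

Lemma adjacent_levels a b c :
  line_levels a b c -> a <> b -> b = a + 1 \/ a = b + 1.
Proof. by move=> [[? _]|[_ ?]|[_ ?]] // _; [left|right]. Qed.

(* The points of the Desargues configuration are the edges of the complete
   graph on five vertices and its lines are the triangles: [a], [b], [c], [d]
   are the edges at one vertex, [ab] is the third edge of the triangle
   spanned by [a] and [b], and so on. *)
Lemma no_desargues_levels a b c d ab ac ad bc bd cd :
  line_levels a b ab -> line_levels a c ac -> line_levels a d ad ->
  line_levels b c bc -> line_levels b d bd -> line_levels c d cd ->
  line_levels ab ac bc -> line_levels ab ad bd -> line_levels ac ad cd ->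
  line_levels bc bd cd -> False.
Proof.
move=> hab hac had hbc hbd hcd habc habd hacd hbcd.
have C := line_levelsC; have AC := line_levelsAC.
(* The ten hypotheses are symmetric in the four edges up to reordering each triple, so one lemma
   separates all six pairs. *)
have nab : a <> b by apply: (four_concurrent_levels_neq hab hac had hbc hbd hcd).
have nac : a <> c.
  apply: (four_concurrent_levels_neq hac hab had (C _ _ _ hbc) hcd hbd) => //.
  exact: C.
have nad : a <> d.
  apply: (four_concurrent_levels_neq had hab hac (C _ _ _ hbd) (C _ _ _ hcd)
    hbc) => //; exact: C.
have nbc : b <> c.
  apply: (four_concurrent_levels_neq hbc (C _ _ _ hab) hbd (C _ _ _ hac) hcd had) => //.
    exact/C/AC.
  exact/AC.
have nbd : b <> d.
  apply: (four_concurrent_levels_neq hbd (C _ _ _ hab)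
    hbc (C _ _ _ had) (C _ _ _ hcd) hac).
  - exact/C/AC.
  - exact/C.
  - exact/AC.
have ncd : c <> d.
  apply: (four_concurrent_levels_neq hcd (C _ _ _ hac)
    (C _ _ _ hbc) (C _ _ _ had) (C _ _ _ hbd) hab).
  - exact/C/AC.
  - exact/C/AC.
  - exact/AC/C.
case: (adjacent_levels hab nab) => eb; case: (adjacent_levels hac nac) => ec;
  case: (adjacent_levels had nad) => ed.
- by apply: nbc; rewrite eb ec.
- by apply: nbc; rewrite eb ec.
- by apply: nbd; rewrite eb ed.
- by apply: ncd; apply: (addIr 1); rewrite -ec -ed.
- by apply: ncd; rewrite ec ed.
- by apply: nbd; apply: (addIr 1); rewrite -eb -ed.
- by apply: nbc; apply: (addIr 1); rewrite -eb -ec.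
- by apply: nbc; apply: (addIr 1); rewrite -eb -ec.
Qed.

End Levels.

Lemma Zp_two_neq0 (m : nat) : (3 <= m)%N -> 1 + 1 != 0 :> 'Z_m.
Proof. by case: m => [|[|[|n]]] // _; rewrite -val_eqE /= !modn_small. Qed.

(** * Lines, perspective triangles and focuses in the weaved configuration *)

Section Weave.
Variables (S : Type) (L : set (set S)) (m : nat).
Hypotheses (hL : is_psts L) (hm : (3 <= m)%N).
Local Notation W := (weave m L).
Implicit Types (A B : set (S * 'Z_m)) (x y z w : S * 'Z_m).

(** An ordered description of a line of [W] that does not single out the raised point, so its points
    can be permuted. *)
Record weave_triple x y z : Prop := WeaveTriple {
  weave_triple_line : L [set x.1; y.1; z.1];
  weave_triple_levels : line_levels x.2 y.2 z.2 }.

Lemma weave_tripleC x y z : weave_triple x y z -> weave_triple y x z.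
Proof. by case=> h1 h2; split; [rewrite set3C|apply: line_levelsC]. Qed.

Lemma weave_tripleAC x y z : weave_triple x y z -> weave_triple x z y.
Proof. by case=> h1 h2; split; [rewrite set3AC|apply: line_levelsAC]. Qed.

Lemma weave_triple_neq x y z :
  weave_triple x y z -> [/\ x.1 <> y.1, x.1 <> z.1 & y.1 <> z.1].
Proof. by case=> h _; apply: card_set3_neq; apply: hL.1. Qed.

Lemma weave_triple_fun x y z w :
  weave_triple x y z -> weave_triple x y w -> z = w.
Proof.
move=> hz hw; have [nxy nxz nyz] := weave_triple_neq hz.
have [lz ez] := hz; have [lw ew] := hw.
have E : [set x.1; y.1; z.1] = [set x.1; y.1; w.1].
  apply: (hL.2 _ _ _ _ lz lw nxy); [exact: mem3a|exact: mem3b|exact: mem3a|exact: mem3b].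
have e1 : z.1 = w.1.
  by have := mem3c x.1 y.1 z.1; rewrite E set3E => -[] // /esym.
have e2 := line_levels_fun (Zp_two_neq0 hm) ez ew.
by rewrite [z]surjective_pairing e1 e2 -surjective_pairing.
Qed.

Lemma weave_third A x y : W A -> A x -> A y -> x <> y ->
  exists2 z, weave_triple x y z & A = [set x; y; z].
Proof.
move=> [a [b [c [i [Labc ->]]]]].
have t1 : weave_triple (a, i) (b, i) (c, i + 1) by split=> //; apply: Or31.
(* All six orderings, one for each possible pair [x], [y]. *)
have t2 := weave_tripleC t1; have t3 := weave_tripleAC t1.
have t4 := weave_tripleAC t2; have t5 := weave_tripleC t3.
have t6 := weave_tripleC t4.
rewrite !set3E => -[->|->|->] [->|->|->] // _.
- by exists (c, i + 1).
- by exists (b, i) => //; rewrite set3AC.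
- by exists (c, i + 1) => //; rewrite set3C.
- by exists (a, i) => //; rewrite (set3C (a, i)) (set3AC (b, i)).
- by exists (b, i) => //; rewrite (set3AC (a, i)) (set3C (a, i)).
- by exists (a, i) => //; rewrite (set3AC (a, i)) (set3C (a, i)) (set3AC (c, i + 1)).
Qed.

Lemma weave_psts_unique A B x y : W A -> W B -> x <> y ->
  A x -> A y -> B x -> B y -> A = B.
Proof.
move=> WA WB nxy Ax Ay Bx By.
have [z tz ->] := weave_third WA Ax Ay nxy.
have [w tw ->] := weave_third WB Bx By nxy.
by rewrite (weave_triple_fun tz tw).
Qed.

Lemma weave_line_levels A x y z : W A -> A x -> A y -> A z ->
  x <> y -> x <> z -> y <> z -> line_levels x.2 y.2 z.2.
Proof.
move=> WA Ax Ay + nxy nxz nyz.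
have [w [_ h] ->] := weave_third WA Ax Ay nxy.
by rewrite set3E => -[/esym|/esym|->].
Qed.

(** The set has three distinct elements, which cannot all lie among two points. *)
Lemma weave_line_neq x y z : W [set x; y; z] -> [/\ x <> y, x <> z & y <> z].
Proof.
move=> [a [b [c [i [Labc E]]]]].
have [nab nac nbc] := card_set3_neq (hL.1 _ Labc).
have uv : (a, i) <> (b, i) by case.
have uw : (a, i) <> (c, i + 1) by case.
have vw : (b, i) <> (c, i + 1) by case.
have := mem3a (a, i) (b, i) (c, i + 1).
have := mem3b (a, i) (b, i) (c, i + 1).
have := mem3c (a, i) (b, i) (c, i + 1).
rewrite -E !set3E => hw hv hu.
by split=> e; subst; case: hu hv hw => -> [] -> [] -> in uv uw vw *.
Qed.

Lemma perspectiveC p (x y : 'I_3 -> S * 'Z_m) :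
  perspective W p x y -> perspective W p y x.
Proof.
move=> [[tx ty] [xi yi nxy] Lp pi]; split=> //.
- by split=> // j k /esym; apply: nxy.
- by move=> j; rewrite set3AC.
- by move=> j k /=; rewrite set3AC [RHS]set3AC => /pi.
Qed.

Lemma focusC (x y : 'I_3 -> S * 'Z_m) j k f : focus W x y j k f -> focus W y x j k f.
Proof. by move=> [A [B [hA [hB [Af Bf]]]]]; exists B, A. Qed.

Lemma focus_swap (x y : 'I_3 -> S * 'Z_m) j k f :
  focus W x y j k f -> focus W x y k j f.
Proof. by move=> [A [B [[? ? ?] [[? ? ?] ?]]]]; exists A, B. Qed.

(** Otherwise the side [B] of [y] contains [x j] and [y j], so it is the line from [p] through them;
    then it contains [p] and [y k], so it is also the line from [p] through [x k]. The lines through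
    the center are distinct. *)
Lemma focus_neq p (x y : 'I_3 -> S * 'Z_m) j k f :
  perspective W p x y -> j != k -> focus W x y j k f -> x j <> f.
Proof.
move=> [_ [_ yi nxy] Lp pi] njk [A [B [_ [[WB Byj Byk] [_ Bf]]]]] E.
rewrite -E in Bf.
have [npxj npyj _] := weave_line_neq (Lp j).
have [_ npyk _] := weave_line_neq (Lp k).
have Bj : B = [set p; x j; y j].
  apply: (weave_psts_unique WB (Lp j) (nxy j j)) => //;
    [exact: mem3b|exact: mem3c].
have Bp : B p by rewrite Bj; apply: mem3a.
have Bk : B = [set p; x k; y k].
  by apply: (weave_psts_unique WB (Lp k) npyk) => //; [exact: mem3a|exact: mem3c].
by move/eqP: njk; apply; apply: pi; rewrite /= -Bj.
Qed.

Lemma focus_levels p (x y : 'I_3 -> S * 'Z_m) j k f :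
  perspective W p x y -> j != k -> focus W x y j k f ->
  line_levels (x j).2 (x k).2 f.2.
Proof.
move=> per njk fo; have [_ [xi _ _] _ _] := per.
have nf := focus_neq per njk fo.
have nf' : x k <> f.
  by apply: focus_neq per _ (focus_swap fo); rewrite eq_sym.
have [A [B [[WA Aj Ak] [_ [Af _]]]]] := fo.
by apply: (weave_line_levels WA) => // /xi/eqP; apply/negP.
Qed.

(** A common focus and [x k] would lie on two sides of [x], which would then coincide and carry all
    three vertices. *)
Lemma focuses_neq p (x y f : 'I_3 -> S * 'Z_m) i j k :
  perspective W p x y -> focuses W x y f -> uniq [:: i; j; k] -> f i <> f j.
Proof.
move=> per fo u E; have := u.
rewrite /= !inE negb_or => /andP[/andP[nij nik] /andP[njk _]].
have fi := fo i j k u.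
have fj : focus W x y i k (f j).
  by apply: fo; rewrite /= !inE negb_or eq_sym nij njk nik.
have nk : x k <> f i.
  by apply: focus_neq per _ (focus_swap fi); rewrite eq_sym.
have [A [_ [[WA Aj Ak] [_ [Af _]]]]] := fi.
have [B [_ [[WB Bi Bk] [_ [Bf _]]]]] := fj.
rewrite -E in Bf.
have AB := weave_psts_unique WA WB nk Ak Af Bk Bf.
have [[[_ nx] _] _ _ _] := per; apply: nx; exists A => // l.
by have := mem_uniq_ord3 l u; rewrite !inE => /or3P[] /eqP-> //; rewrite AB.
Qed.

Lemma weave_anti_desarguesian : anti_desarguesian W.
Proof.
move=> p x y f per fo [D WD Df].
have [_ _ Lp _] := per.
have lp j : line_levels p.2 (x j).2 (y j).2.
  have [n1 n2 n3] := weave_line_neq (Lp j).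
  by apply: (weave_line_levels (Lp j)) => //; [exact: mem3a|exact: mem3b|exact: mem3c].
have lx i j k : uniq [:: i; j; k] -> line_levels (x j).2 (x k).2 (f i).2.
  move=> u; apply: (focus_levels per _ (fo i j k u)).
  by case/and3P: u => _; rewrite inE.
have ly i j k : uniq [:: i; j; k] -> line_levels (y j).2 (y k).2 (f i).2.
  move=> u; apply: (focus_levels (perspectiveC per) _ (focusC (fo i j k u))).
  by case/and3P: u => _; rewrite inE.
have nf i j k : uniq [:: i; j; k] -> f i <> f j by exact: focuses_neq per fo.
have lf : line_levels (f 2%:R).2 (f 1).2 (f 0).2.
  apply: (weave_line_levels WD) => //.
  - exact: (nf _ _ 0).
  - exact: (nf _ _ 1).
  - exact: (nf _ _ 2%:R).
(* The edges at the chosen vertex are [p], [x 0], [x 1], [x 2]. The third edges are the [y j] for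
   pairs with [p] and the focuses for pairs of [x]; the axis, in the order 2, 1, 0, is the last
   triangle. *)
apply: (no_desargues_levels (Zp_two_neq0 hm) (lp 0) (lp 1) (lp 2%:R)
  (lx 2%:R 0 1 _) (lx 1 0 2%:R _) (lx 0 1 2%:R _)
  (ly 2%:R 0 1 _) (ly 1 0 2%:R _) (ly 0 1 2%:R _) lf) => //.
Qed.

End Weave.

(** * From Desargues subconfigurations to perspective triangles *)

Lemma desargues_subconfiguration_perspective (S : Type) (L : set (set S))
    (P : set S) (K : set (set S)) :
  (forall A B x y, L A -> L B -> x <> y -> A x -> A y -> B x -> B y -> A = B) ->
  desargues_subconfiguration L P K ->
  exists (p : S) (x y f : 'I_3 -> S),
    [/\ perspective L p x y, focuses L x y f & on_common_line L f].
Proof.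
move=> LU [[p [x [y [f [PE Pcard KE _]]]]] KL].
exists p, x, y, f.
(* The index type has 1 + 3 + 3 + 3 = 10 elements, so the count of ten points makes all the named
   points distinct; every non-degeneracy condition below rests on this. *)
pose g (d : option ('I_3 + 'I_3 + 'I_3)) : S := match d with
  | None => p | Some (inl (inl j)) => x j
  | Some (inl (inr j)) => y j | Some (inr j) => f j end.
have ginj : injective g.
  apply: (@card_range_inj _ _ _ 10).
    by rewrite card_option !card_sum !card_ord.
  have -> : range g = P; last by [].
  rewrite PE; apply/seteqP; split=> z.
    move=> [[[[j|j]|j]|] _ <-] /=.
    - by left; left; right; exists j.
    - by left; right; exists j.
    - by right; exists j.
    - by left; left; left.
  move=> [[[->|[j _ <-]]|[j _ <-]]|[j _ <-]].
  - by exists None.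
  - by exists (Some (inl (inl j))).
  - by exists (Some (inl (inr j))).
  - by exists (Some (inr j)).
have xi : injective x.
  by move=> j k e; have [] := ginj (Some (inl (inl j))) (Some (inl (inl k))) e.
have yi : injective y.
  by move=> j k e; have [] := ginj (Some (inl (inr j))) (Some (inl (inr k))) e.
have nxy j k : x j <> y k by move=> /(ginj (Some (inl (inl j))) (Some (inl (inr k)))).
have nxf j k : x j <> f k by move=> /(ginj (Some (inl (inl j))) (Some (inr k))).
have nyf j k : y j <> f k by move=> /(ginj (Some (inl (inr j))) (Some (inr k))).
have npx j : x j <> p by move=> /(ginj (Some (inl (inl j))) None).
have Lp j : L [set p; x j; y j] by apply: KL; rewrite KE; do 3 left; exists j.
have Lx i j k : uniq [:: i; j; k] -> L [set x j; x k; f i].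
  by move=> u; apply: KL; rewrite KE; left; left; right; exists i, j, k.
have Ly i j k : uniq [:: i; j; k] -> L [set y j; y k; f i].
  by move=> u; apply: KL; rewrite KE; left; right; exists i, j, k.
have Lf : L (range f) by apply: KL; rewrite KE; right.
have tri (z : 'I_3 -> S) : injective z -> (forall j k, z j <> f k) ->
    (forall i j k, uniq [:: i; j; k] -> L [set z j; z k; f i]) -> triangle L z.
  move=> zi nzf Lz; split=> [j k /ord3_third[i u]|[A LA Az]].
    by exists [set z j; z k; f i]; split; [exact: Lz|exact: mem3a|exact: mem3b].
  (* A line carrying all three vertices would be this side, whose points all differ from [z 0]. *)
  have E : A = [set z 1; z 2%:R; f 0].
    apply: (LU _ _ (z 1) (z 2%:R) LA) => //; first exact: Lz.
    - by move=> /zi.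
    - exact: mem3a.
    - exact: mem3b.
  by have := Az 0; rewrite E set3E => -[/zi|/zi|/nzf].
split.
- split=> //; first by split; exact: tri.
  move=> j k /= E; have := mem3b p (x j) (y j); rewrite E set3E.
  by move=> [/npx|/xi|/nxy].
- move=> i j k u; exists [set x j; x k; f i], [set y j; y k; f i].
  split; first by split; [exact: Lx|exact: mem3a|exact: mem3b].
  split; first by split; [exact: Ly|exact: mem3a|exact: mem3b].
  by split; exact: mem3c.
- by exists (range f) => // j; exists j.
Qed.

Theorem proposition2p9 (S : Type) (L : set (set S)) (m : nat)
    (hL : is_psts L) (hm : (3 <= m)%N) :
  (~ exists (P : set (S * 'Z_m)) (K : set (set (S * 'Z_m))),
       desargues_subconfiguration (weave m L) P K) /\
  anti_desarguesian (weave m L).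
Proof.
have aD := weave_anti_desarguesian hL hm; split=> // -[P [K PK]].
have [p [x [y [f [per fo]]]]] :=
  desargues_subconfiguration_perspective (weave_psts_unique hL hm) PK.
exact: aD per fo.
Qed.
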